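(* Fix $c\in\mathbb{C}$ and let $X\subset (c\cdot\mathbf 1)+c_0$ be nonempty, locally box-open, permutation-invariant, and $c_{00}$-chain-connected, where $\mathbf 1=(1,1,\ldots)$. Let $Y$ be a locally convex complex topological vector space with continuous dual $Y^*$. Suppose $\Sigma:X\to Y$ satisfies $\Sigma(x\circ\sigma)=\Sigma(x)$ for all $x\in X$ and $\sigma\in S_{\mathrm{fin}}$, and that for every $\lambda\in Y^*$ the scalar function $g=\lambda\circ\Sigma:X\to\mathbb{C}$ is admissibly holomorphic with bounded differential, invariant under all finite permutations, and satisfies $Dg(x)[h]=0$ for all $x\in X$ and all $h\in c_{00}$. Then: (i) $\lambda\circ\Sigma$ is constant for every $\lambda\in Y^*$; (ii) if $Y^*$ separates the points of $Y$, then $\Sigma$ is constant.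
   Context: Let $\ell^\infty$ be the space of bounded complex sequences indexed by $\mathbb{N}$ with norm $\|\cdot\|_\infty$, $c_0\subset\ell^\infty$ the closed subspace of sequences tending to $0$, and $c_{00}\subset c_0$ the subspace of finitely supported complex sequences. $e_k$ is the sequence with $1$ in position $k$ and $0$ elsewhere. $S_{\mathrm{fin}}$ is the group of bijections $\sigma:\mathbb{N}\to\mathbb{N}$ fixing all but finitely many elements, acting on $\mathbb{C}^{\mathbb{N}}$ by $(x\circ\sigma)_n=x_{\sigma(n)}$. A subset $X\subset\mathbb{C}^{\mathbb{N}}$ is: permutation-invariant if $x\circ\sigma\in X$ for all $x\in X$, $\sigma\in S_{\mathrm{fin}}$; locally box-open if for every $x\in X$ there is $r>0$ with $x+h\in X$ for all $h\in c_{00}$ with $\|h\|_\infty<r$; $c_{00}$-chain-connected if for any $x,y\in X$ there is a finite sequence $x=z_0,z_1,\ldots,z_m=y$ in $X$ with $z_{\ell+1}-z_\ell\in c_{00}$ and $\{z_\ell+t(z_{\ell+1}-z_\ell):t\in[0,1]\}\subset X$ for each $\ell$. A function $f:X\to\mathbb{C}$ on a locally box-open, permutation-invariant set $X\subset\mathbb{C}^{\mathbb{N}}$ is admissibly holomorphic if it carries a differential datum $x\mapsto Df(x)$, where each $Df(x):c_{00}\to\mathbb{C}$ is $\mathbb{C}$-linear, such that: (i) for every $x\in X$ and $k\in\mathbb{N}$, the map $\varepsilon\mapsto f(x+\varepsilon e_k)$ is holomorphic in a neighborhood of $0\in\mathbb{C}$; (ii) for every $x\in X$ there is a constant $C_x$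 with $|Df(x)[h]|\le C_x\|h\|_\infty$ for all $h\in c_{00}$ (this is what ''bounded differential'' means), and $f(x+h)=f(x)+Df(x)[h]+o(\|h\|_\infty)$ as $h\to0$ in $c_{00}$ (with respect to $\|\cdot\|_\infty$). *)

(* Defs.v *)
From HB Require Import structures.
From mathcomp Require Import all_boot all_order all_algebra.
From mathcomp Require Import complex.
From mathcomp Require Import all_classical all_reals all_analysis.

Set Implicit Arguments.
Unset Strict Implicit.
Unset Printing Implicit Defensive.
Import Order.TTheory GRing.Theory Num.Theory.
Import numFieldNormedType.Exports.

Local Open Scope classical_set_scope.
Local Open Scope ring_scope.
Local Open Scope complex_scope.

(* [R[i]^o] is [R[i]] seen as a module over itself; this is the form under which
   the library equips it with its norm topology. *)
Notation cplx R := (R[i]^o).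

Notation cseq R := (nat -> cplx R).

(* The real-valued modulus ([`|z|] lives in [R[i]]). *)
Notation modulus := ComplexField.Normc.normc.

Section SequenceSpaces.
Variable R : realType.
Implicit Types (x h : cseq R) (s : nat -> nat) (X : set (cseq R)).

(* Only meaningful for bounded [x], since [sup] is [0] on unbounded sets. *)
Definition norm_infty x : R := sup (range (fun n => modulus (x n))).

(* Boundedness is automatic for convergent sequences. *)
Definition c0 : set (cseq R) := [set x : cseq R | x @ \oo --> (0 : cplx R)].

Definition c00 : set (cseq R) := [set x : cseq R | finite_set [set n | x n != 0]].

Definition e_ (k : nat) : cseq R := fun n => (n == k)%:R.

Definition Sfin : set (nat -> nat) :=
  [set s : nat -> nat | bijective s /\ finite_set [set n | s n != n]].

Definition permutation_invariant X :=
  forall x s, X x -> Sfin s -> X (x \o s).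

Definition locally_box_open X :=
  forall x, X x -> exists2 r : R, 0 < r &
    forall h, c00 h -> norm_infty h < r -> X (x + h).

Definition c00_chain_connected X :=
  forall x y, X x -> X y -> exists (m : nat) (z : nat -> cseq R),
    [/\ z 0%N = x, z m = y, forall l, (l <= m)%N -> X (z l) &
        forall l, (l < m)%N -> c00 (z l.+1 - z l) /\
          forall t : R, 0 <= t <= 1 -> X (z l + t%:C *: (z l.+1 - z l))].

End SequenceSpaces.

Section AdmissiblyHolomorphic.
Variable R : realType.
Variables (X : set (cseq R)) (f : cseq R -> cplx R).

(* [f] is admissibly holomorphic on [X] with differential datum [Df].  Functions
   on [X] are represented by total functions whose values outside [X] are
   irrelevant: [X] being locally box-open, the conditions below only involve
   values of [f] on [X].  Likewise only the values of [Df x] on [c00] matter. *)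
Record admissibly_holomorphic_with (Df : cseq R -> cseq R -> cplx R) : Prop := {
  adm_linear : forall x, X x -> forall (a : R[i]) (h k : cseq R),
    c00 h -> c00 k -> Df x (a *: h + k) = a *: Df x h + Df x k ;
  adm_holomorphic : forall x (k : nat), X x ->
    \forall z \near (0 : cplx R),
      derivable (fun eps : cplx R => f (x + eps *: e_ R k)) z 1 ;
  adm_bounded : forall x, X x -> exists Cx : R, forall h, c00 h ->
    modulus (Df x h) <= Cx * norm_infty h ;
  adm_expansion : forall x, X x -> forall eps : R, 0 < eps ->
    exists2 delta : R, 0 < delta & forall h, c00 h -> norm_infty h < delta ->
      modulus (f (x + h) - f x - Df x h) <= eps * norm_infty h }.

End AdmissiblyHolomorphic.

Definition constant_on (T U : Type) (X : set T) (f : T -> U) :=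
  exists a : U, forall x, X x -> f x = a.

(* Elements of the continuous dual [Y^*] are the [lam : {linear Y -> cplx R}]
   that are [continuous]. *)
Definition dual_separates_points (R : realType) (Y : tvsType R[i]) :=
  forall y1 y2 : Y, y1 <> y2 ->
    exists2 lam : {linear Y -> cplx R}, continuous lam & lam y1 <> lam y2.

(* Main.v *)
Require Import Defs.
From mathcomp Require Import all_boot all_order all_algebra.
From mathcomp Require Import complex.
From mathcomp Require Import all_classical all_reals all_analysis.
Import Order.TTheory GRing.Theory Num.Theory.
Import numFieldNormedType.Exports.
Local Open Scope classical_set_scope.
Local Open Scope ring_scope.

(* Write f for the composite of Sigma with a continuous functional.  Along a
   segment of a chain, t |-> f (z + t d) has zero derivative by the first-order
   expansion, hence is constant by the mean value theorem applied to its real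
   and imaginary parts. *)

Set Implicit Arguments.
Unset Strict Implicit.
Local Open Scope complex_scope.

Lemma modulus_ge0 (R : realType) (w : R[i]) : 0 <= modulus w.
Proof. by case: w => a b; exact: sqrtr_ge0. Qed.

Lemma c00_bounded (R : realType) (d : cseq R) : c00 d ->
  exists2 M : R, 0 < M & forall n, modulus (d n) <= M.
Proof.
move=> /finite_seqP[r dr].
have sum_ge0 (u : seq nat) : 0 <= \sum_(i <- u) modulus (d i).
  by apply: sumr_ge0 => i _; exact: modulus_ge0.
(* The summand 1 keeps the bound positive even for [d = 0], so that one may divide by it. *)
exists (1 + \sum_(i <- r) modulus (d i)); first by rewrite ltr_wpDr.
move=> n; have [->|dn] := eqVneq (d n) 0.
  by rewrite Normc.normc0 addr_ge0.
have nr : n \in r by have : [set n | d n != 0] n by []; rewrite dr.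
by rewrite (big_rem n nr) /= addrCA lerDl addr_ge0.
Qed.

Lemma norm_infty_le (R : realType) (x : cseq R) (M : R) :
  (forall n, modulus (x n) <= M) -> norm_infty x <= M.
Proof.
move=> xM; apply: ge_sup; first by exists (modulus (x 0%N)), 0%N.
by move=> _ [n _ <-].
Qed.

Lemma modulus_scale (R : realType) (s : R) (w : cplx R) :
  modulus (s%:C *: w) = `|s| * modulus w.
Proof.
by rewrite Normc.normcM /= expr0n addr0 sqrtr_sqr.
Qed.

Lemma c00_scale (R : realType) (a : R[i]) (d : cseq R) : c00 d -> c00 (a *: d).
Proof.
apply: sub_finite_set => n /=; apply: contra => /eqP dn.
by rewrite fctE dn scaler0.
Qed.

Lemma Re_le_modulus (R : realType) (w : R[i]) : `|complex.Re w| <= modulus w.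
Proof.
by case: w => a b /=; rewrite -sqrtr_sqr ler_wsqrtr // lerDl sqr_ge0.
Qed.

Lemma Im_le_modulus (R : realType) (w : R[i]) : `|complex.Im w| <= modulus w.
Proof.
by case: w => a b /=; rewrite -sqrtr_sqr ler_wsqrtr // lerDr sqr_ge0.
Qed.

(** Dividing the increment estimate by [|s|] bounds the difference quotient by [eps] near 0, for
    every [eps]. The hypothesis has the shape that the first-order expansion takes when the
    differential vanishes. *)
Lemma is_derive0_small (R : realType) (psi : R -> R) (t : R) :
  (forall eps, 0 < eps -> exists2 delta, 0 < delta & forall s, `|s| < delta ->
     `|psi (t + s) - psi t| <= eps * `|s|) ->
  is_derive t 1 psi 0.
Proof.
move=> psi0.
have cvg0 : h^-1 *: (psi (h *: 1 + t) - psi t) @[h --> 0^'] --> (0 : R).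
  apply/cvgrPdist_le => eps eps0.
  have [delta delta0 Hd] := psi0 _ eps0.
  near=> h.
  have h0 : h != 0 by near: h; exact: nbhs_dnbhs_neq.
  have hd : `|h| < delta by near: h; apply: dnbhs0_lt.
  rewrite sub0r normrN normrZ normfV mulrC ler_pdivrMr ?normr_gt0 //.
  by rewrite [h *: 1]mulr1 [h + t]addrC; exact: Hd.
apply: DeriveDef; first by apply/cvg_ex; exists 0.
exact: cvg_lim cvg0.
Unshelve. all: by end_near. Qed.

(** Derivatives at 0 and 1 give the continuity on the closed interval that the mean value theorem
    asks for. *)
Lemma eq_endpoints_is_derive0 (R : realType) (psi : R -> R) :
  (forall t : R, 0 <= t <= 1 -> is_derive t 1 psi 0) -> psi 1 = psi 0.
Proof.
move=> D.
have [||t _] := @MVT_segment R psi (fun=> 0) 0 1 ler01.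
- move=> t; rewrite in_itv /= => /andP[t0 t1]; apply: D.
  by rewrite (ltW t0) (ltW t1).
- apply: derivable_within_continuous => t; rewrite in_itv /= => /D [].
  by [].
- by rewrite mul0r => /eqP; rewrite subr_eq0 => /eqP.
Qed.

Lemma eq_segment_diff0 (R : realType) (X : set (cseq R)) (f : cseq R -> cplx R)
    (Df : cseq R -> cseq R -> cplx R) (z d : cseq R) :
  admissibly_holomorphic_with X f Df ->
  (forall x h, X x -> c00 h -> Df x h = 0) ->
  c00 d -> (forall t : R, 0 <= t <= 1 -> X (z + t%:C *: d)) ->
  f (z + d) = f z.
Proof.
move=> fD Df0 dc Xseg.
have [M M0 dM] := c00_bounded dc.
have le_norm (s : R) : norm_infty (s%:C *: d) <= `|s| * M.
  apply: norm_infty_le => n.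
  by rewrite fctE modulus_scale ler_wpM2l.
(* Here [s] has either sign and [t + s] may leave the unit interval: the expansion at [z + t d]
   covers every small increment in [c00]. Two-sided derivatives thus exist at the endpoints too. *)
have small (t : R) : 0 <= t <= 1 -> forall eps : R, 0 < eps ->
    exists2 delta : R, 0 < delta & forall s, `|s| < delta ->
      modulus (f (z + (t + s)%:C *: d) - f (z + t%:C *: d)) <= eps * `|s|.
  move=> /Xseg Xt eps eps0.
  (* Since [s d] has norm at most [|s| M], the tolerance [eps / M] and the radius [delta / M] absorb
     the factor [M]. *)
  have [delta delta0 Hd] := adm_expansion fD Xt (divr_gt0 eps0 M0).
  exists (delta / M); first exact: divr_gt0.
  move=> s; rewrite ltr_pdivlMr // => sd.
  have dsc := c00_scale s%:C dc.
  have := Hd _ dsc (le_lt_trans (le_norm s) sd).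
  rewrite Df0 // subr0 -addrA -scalerDl -rmorphD => /le_trans; apply.
  rewrite -mulrA ler_wpM2l ?(ltW eps0) //.
  by rewrite mulrC ler_pdivrMr.
(* [P] stands for the real or the imaginary part; both respect differences and are bounded by the
   modulus, so the estimate [small] passes to [P] composed with [f]. *)
suff eqP (P : R[i] -> R) : {morph P : u v / u - v} ->
    (forall w, `|P w| <= modulus w) -> P (f (z + d)) = P (f z).
  have ReB : {morph @complex.Re R : u v / u - v} by case=> ? ? [].
  have ImB : {morph @complex.Im R : u v / u - v} by case=> ? ? [].
  have := eqP _ ReB (@Re_le_modulus R); have := eqP _ ImB (@Im_le_modulus R).
  by case: (f (z + d)) (f z) => [a b] [a' b'] /= -> ->.
move=> PB PM.
have /= := @eq_endpoints_is_derive0 R (fun t => P (f (z + t%:C *: d))).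
rewrite scale1r scale0r addr0; apply=> t t01.
apply: is_derive0_small => eps eps0.
have [delta delta0 Hd] := small t t01 eps eps0.
exists delta => // s /Hd; apply: le_trans.
by rewrite -PB.
Qed.

(** Each link of a chain from [x0] to [x] is a segment in [X] with direction in [c00], so induction
    along the chain carries the value [f x0] to [x]. *)
Lemma constant_on_chain_connected_diff0 (R : realType) (X : set (cseq R))
    (f : cseq R -> cplx R) (Df : cseq R -> cseq R -> cplx R) :
  c00_chain_connected X -> X !=set0 ->
  admissibly_holomorphic_with X f Df ->
  (forall x h, X x -> c00 h -> Df x h = 0) ->
  constant_on X f.
Proof.
move=> Xconn [x0 Xx0] fD Df0; exists (f x0) => x Xx.
have [m [z [z0 zm Xz zseg]]] := Xconn _ _ Xx0 Xx.
suff fz l : (l <= m)%N -> f (z l) = f x0 by rewrite -zm fz.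
elim: l => [|l IHl] lm; first by rewrite z0.
have [dc Xseg] := zseg _ lm.
by rewrite -(IHl (ltnW lm)) -(eq_segment_diff0 fD Df0 dc Xseg) addrC subrK.
Qed.

Local Close Scope complex_scope.
Unset Implicit Arguments.
Set Strict Implicit.

Theorem corollary4p4 (R : realType) (c : R[i]) (X : set (cseq R))
    (hXc0 : X `<=` [set cst c + u | u in @c0 R])
    (hX0 : X !=set0)
    (hXopen : locally_box_open X)
    (hXperm : permutation_invariant X)
    (hXconn : c00_chain_connected X)
    (Y : tvsType R[i]) (Sigma : cseq R -> Y)
    (hSigma : forall x s, X x -> Sfin s -> Sigma (x \o s) = Sigma x)
    (hdual : forall lam : {linear Y -> cplx R}, continuous lam ->
      exists Dg : cseq R -> cseq R -> cplx R,
        [/\ admissibly_holomorphic_with X (lam \o Sigma) Dg,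
            forall x s, X x -> Sfin s ->
              (lam \o Sigma) (x \o s) = (lam \o Sigma) x &
            forall x h, X x -> c00 h -> Dg x h = 0]) :
  (forall lam : {linear Y -> cplx R}, continuous lam ->
     constant_on X (lam \o Sigma)) /\
  (dual_separates_points Y -> constant_on X Sigma).
Proof.
have H (lam : {linear Y -> cplx R}) :
    continuous lam -> constant_on X (lam \o Sigma).
  move=> /hdual[Dg [gD _ Dg0]].
  exact: constant_on_chain_connected_diff0 hXconn hX0 gD Dg0.
split=> // sep; have [x0 Xx0] := hX0; exists (Sigma x0) => x Xx.
(* If [Sigma x] and [Sigma x0] differed, some continuous functional would separate them, although
   its composite with [Sigma] is constant on [X]. *)
apply: contrapT => /sep[lam /H[a lama]]; apply.
by rewrite [LHS](lama _ Xx) [RHS](lama _ Xx0).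
Qed.
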